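(* For all integers $n\ge 1$ and $1\le k\le n$, $$\sum_{(\sigma,S)\in\mathfrak{S}^{>}_{n,n-k}} q^{\operatorname{maj}((\sigma,S))} = \sum_{i=1}^{k} q^{\binom{n-k}{2} - (n-k)(n-i)} {n-i \brack n-k}_q A_{n,n-i}(q).$$
   Context: $\mathfrak{S}_n$ is the set of permutations $\sigma=\sigma_1\cdots\sigma_n$ of $\{1,\dots,n\}$. For $\sigma\in\mathfrak{S}_n$: $\operatorname{Des}(\sigma)=\{i\in\{1,\dots,n-1\}:\sigma_i>\sigma_{i+1}\}$, $\operatorname{des}(\sigma)=|\operatorname{Des}(\sigma)|$, $\operatorname{maj}(\sigma)=\sum_{i\in\operatorname{Des}(\sigma)}i$. $\mathfrak{S}^{>}_{n,m}=\{(\sigma,S):\sigma\in\mathfrak{S}_n,\ S\subseteq\operatorname{Des}(\sigma),\ |S|=m\}$ (descent-starred permutations), and for $(\sigma,S)\in\mathfrak{S}^{>}_{n,m}$, $$\operatorname{maj}((\sigma,S))=\operatorname{maj}(\sigma)-\sum_{i\in S}|\operatorname{Des}(\sigma)\cap\{i,i+1,\dots,n-1\}|.$$ $A_{n,j}(q)=\sum_{\sigma\in\mathfrak{S}_n,\ \operatorname{des}(\sigma)=j}q^{\operatorname{maj}(\sigma)}$ is the coefficient of $t^j$ in $\sum_{\sigma\in\mathfrak{S}_n}q^{\operatorname{maj}(\sigma)}t^{\operatorname{des}(\sigma)}$. $[m]_q=1+q+\cdots+q^{m-1}$, $[m]_q!=[1]_q\cdots[m]_q$, and ${m\brack r}_q=\frac{[m]_q!}{[r]_q![m-r]_q!}$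 for $0\le r\le m$. *)

(* Defs.v *)
From mathcomp Require Import all_boot all_order all_fingroup all_algebra.

Set Implicit Arguments.
Unset Strict Implicit.
Unset Printing Implicit Defensive.

Import GRing.Theory.
Local Open Scope ring_scope.

(* A permutation sigma_1 ... sigma_n of {1, ..., n} is encoded by s : 'S_n with
   sigma_i = s (i - 1) + 1.  Positions keep their 1-based numbering: an element
   i of Des s, as a natural number, is a position i in {1, ..., n-1} with
   sigma_i > sigma_{i+1}, that is, s (i - 1) > s i; for 0 < i, ord_pred i has
   value i - 1. *)
Definition Des (n : nat) (s : 'S_n) : {set 'I_n} :=
  [set i : 'I_n | (0 < i)%N && (s i < s (ord_pred i))%N].

Definition des (n : nat) (s : 'S_n) : nat := #|Des s|.

Definition maj (n : nat) (s : 'S_n) : nat := (\sum_(i in Des s) i)%N.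

Definition starred (n m : nat) : {set 'S_n * {set 'I_n}} :=
  [set sS : 'S_n * {set 'I_n} | (sS.2 \subset Des sS.1) && (#|sS.2| == m)].

(* Integer-valued, so that the subtraction is not truncated. *)
Definition starred_maj (n : nat) (sS : 'S_n * {set 'I_n}) : int :=
  (maj sS.1)%:Z - \sum_(i in sS.2) (#|[set j in Des sS.1 | (i <= j)%N]|)%:Z.

Definition euler_mahonian (F : fieldType) (q : F) (n j : nat) : F :=
  \sum_(s : 'S_n | des s == j) q ^+ maj s.

Definition qint (F : fieldType) (q : F) (m : nat) : F := \sum_(i < m) q ^+ i.

Definition qfact (F : fieldType) (q : F) (m : nat) : F :=
  \prod_(1 <= i < m.+1) qint q i.

(* Meaningful for r <= m and when no q-integer involved vanishes, for instance
   when q is an indeterminate. *)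
Definition qbinom (F : fieldType) (q : F) (m r : nat) : F :=
  qfact q m / (qfact q r * qfact q (m - r)).

(* The indeterminate q, in the field of fractions of Z[q], which contains the
   Laurent polynomials Z[q, q^-1]. *)
Definition qvar : {fraction {poly int}} := tofrac 'X.

(* Main.v *)
Require Import Defs.
From mathcomp Require Import all_boot all_order all_fingroup all_algebra.
From mathcomp Require Import ring zify.

Set Implicit Arguments.
Unset Strict Implicit.
Unset Printing Implicit Defensive.

Import GRing.Theory.
Local Open Scope ring_scope.

(** If [Des s] has [j] elements, the numbers [|Des s :&: {i, i+1, ...}|], for
    [i] in [Des s], are [1, ..., j]. For a fixed [s], summing over the stars [S]
    therefore gives [q^maj(s)] times the elementary symmetric polynomial
    [e_(n-k)(q^-1, ..., q^-j)], which by the q-binomial theorem equals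
    [q^(binom(n-k, 2) - (n-k) j)] times the q-binomial of [j] and [n-k]. *)

Section QBinomial.

Variables (F : fieldType) (q : F).
Hypothesis qint_neq0 : forall i, qint q i.+1 != 0.

Lemma qintD m r : qint q (m + r) = qint q m + q ^+ m * qint q r.
Proof.
rewrite /qint big_split_ord /= mulr_sumr; congr (_ + _).
by apply: eq_bigr => i _; rewrite exprD.
Qed.

Lemma qfact0 : qfact q 0 = 1.
Proof. by rewrite /qfact big_geq. Qed.

Lemma qfactS m : qfact q m.+1 = qfact q m * qint q m.+1.
Proof. by rewrite /qfact big_nat_recr. Qed.

Lemma qfact_neq0 m : qfact q m != 0.
Proof.
by elim: m => [|m IHm]; rewrite ?qfact0 ?oner_eq0 // qfactS mulf_neq0.
Qed.

Lemma qbinom0 m : qbinom q m 0 = 1.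
Proof. by rewrite /qbinom subn0 qfact0 mul1r divff // qfact_neq0. Qed.

Lemma qbinomn m : qbinom q m m = 1.
Proof. by rewrite /qbinom subnn qfact0 mulr1 divff // qfact_neq0. Qed.

(** The q-Pascal rule, from splitting the last factor of [qfact q j.+1] as [[j+1] = [m+1] + q^(m+1)
    [j-m]]. The bound is strict because, with truncated subtraction, [qbinom q j j.+1] is [1/[j+1]]
    and not [0]. *)
Lemma qbinomS m j : (m < j)%N ->
  qbinom q j.+1 m.+1 = q ^+ m.+1 * qbinom q j m.+1 + qbinom q j m.
Proof.
move=> /subnKC <-; set r := (j - m.+1)%N.
rewrite /qbinom.
have -> : ((m.+1 + r).+1 - m.+1 = r.+1)%N by lia.
have -> : (m.+1 + r - m.+1 = r)%N by lia.
have -> : (m.+1 + r - m = r.+1)%N by lia.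
rewrite !qfactS -addnS qintD.
have := qfact_neq0 m; have := qfact_neq0 r.
have := qint_neq0 m; have := qint_neq0 r.
move: (qfact q m) (qfact q r) (qfact q (m.+1 + r)) (qint q m.+1) (qint q r.+1).
move: (q ^+ m.+1) => x a b c d e e0 d0 b0 a0.
by field; rewrite a0 b0 d0 e0.
Qed.

End QBinomial.

Lemma big_subsets_split (R : nmodType) (T : finType) (D : {set T}) (x : T)
    (m : nat) (f : {set T} -> R) : x \in D ->
  \sum_(S : {set T} | (S \subset D) && (#|S| == m.+1)) f S =
  \sum_(S : {set T} | (S \subset D :\ x) && (#|S| == m.+1)) f S +
  \sum_(S : {set T} | (S \subset D :\ x) && (#|S| == m)) f (x |: S).
Proof.
move=> xD; rewrite (bigID (fun S : {set T} => x \notin S)) /=; congr (_ + _).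
  by apply: eq_bigl => S; rewrite subsetD1 andbAC.
rewrite (reindex_onto (fun S => x |: S) (fun S => S :\ x)) /=; last first.
  by move=> S; rewrite negbK => /andP[_ xS]; rewrite setD1K.
(* The reindexing keeps the [S] with [(x |: S) :\ x = S], that is, those avoiding [x]. *)
apply: eq_bigl => S; rewrite subsetD1 setU11 andbT subUset sub1set xD /=.
case: (boolP (x \in S)) => xS.
  rewrite andbF /=; apply/negbTE; rewrite negb_and.
  apply/orP; right; apply/eqP => /setP/(_ x).
  by rewrite !inE eqxx xS.
by rewrite setU1K // eqxx !andbT cardsU1 xS eqSS.
Qed.

Lemma big_subsets_card_lt (R : nmodType) (T : finType) (D : {set T}) (m : nat)
    (f : {set T} -> R) :
  (#|D| < m)%N ->
  \sum_(S : {set T} | (S \subset D) && (#|S| == m)) f S = 0.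
Proof.
move=> ltDm; rewrite big_pred0 // => S; apply/negP => /andP[/subset_leq_card SD].
by move=> /eqP cS; move: SD; rewrite cS leqNgt ltDm.
Qed.

Section StarSum.

Variables (F : fieldType) (q : F).
Hypotheses (q_neq0 : q != 0) (qint_neq0 : forall i, qint q i.+1 != 0).

(** Leaving [c] unrelated to [D] lets it be [0] or [j.+1] once [#|D|] has been rewritten. *)
Lemma star_sum0 (T : finType) (D : {set T}) (w : T -> int) (c : nat) :
  \sum_(S : {set T} | (S \subset D) && (#|S| == 0%N)) q ^ (- \sum_(i in S) w i) =
  q ^ ('C(0, 2)%:Z - (0 * c)%N%:Z) * qbinom q c 0.
Proof.
rewrite (big_pred1 set0) => [|S]; last first.
  by rewrite cards_eq0 /=; case: eqP => [->|]; rewrite ?sub0set ?andbF.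
by rewrite big_set0 oppr0 qbinom0 // bin0n subr0 expr0z mulr1.
Qed.

(** Induction on [#|D|], removing the minimum [x] of [D]. Every element of [D] is at least [x], so
    the subsets containing [x] gain the factor [q^-#|D|]; the two halves recombine by the q-Pascal
    rule. *)
Lemma star_sum (n : nat) (D : {set 'I_n}) (m : nat) : (m <= #|D|)%N ->
  \sum_(S : {set 'I_n} | (S \subset D) && (#|S| == m))
     q ^ (- \sum_(i in S) (#|[set j in D | (i <= j)%N]|)%:Z) =
  q ^ ('C(m, 2)%:Z - (m * #|D|)%N%:Z) * qbinom q #|D| m.
Proof.
have [j cD] : exists j, #|D| = j by exists #|D|.
elim: j => [|j IHj] in D m cD *; case: m => [|m]; rewrite ?cD // => lemD.
- exact: star_sum0.
- exact: star_sum0.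
have [x0 x0D] : exists x, x \in D by apply/card_gt0P; rewrite cD.
pose x := [arg min_(i < x0 in D) (i : nat)].
have [xD x_min] : x \in D /\ forall y, y \in D -> (x <= y)%N.
  by rewrite /x; case: arg_minnP.
have cDx : #|D :\ x| = j by move: cD; rewrite (cardsD1 x) xD => -[].
have rank_x : #|[set y in D | (x <= y)%N]| = j.+1.
  rewrite -cD; apply: eq_card => y; rewrite !inE.
  by case: (boolP (y \in D)) => // /x_min ->.
(* Deleting the minimum of D does not affect the ranks of the other elements. *)
have rank_D1 (S : {set 'I_n}) : S \subset D :\ x ->
    \sum_(i in S) (#|[set y in D | (i <= y)%N]|)%:Z =
    \sum_(i in S) (#|[set y in D :\ x | (i <= y)%N]|)%:Z.
  move=> SD; apply: eq_bigr => i /(subsetP SD); rewrite !inE => /andP[neix iD].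
  congr (_%:Z); apply: eq_card => y; rewrite !inE.
  case: eqP => // ->; rewrite xD /= leqNgt ltn_neqAle x_min // andbT.
  by rewrite eq_sym neix.
rewrite (big_subsets_split _ _ xD).
under eq_bigr => S /andP[SD _] do rewrite rank_D1 //.
have -> : \sum_(S : {set 'I_n} | (S \subset D :\ x) && (#|S| == m))
      q ^ (- \sum_(i in x |: S) (#|[set y in D | (i <= y)%N]|)%:Z) =
    q ^ (- j.+1%:Z) * \sum_(S : {set 'I_n} | (S \subset D :\ x) && (#|S| == m))
      q ^ (- \sum_(i in S) (#|[set y in D :\ x | (i <= y)%N]|)%:Z).
  rewrite mulr_sumr; apply: eq_bigr => S /andP[SD _].
  have xS : x \notin S by move: SD; rewrite subsetD1 => /andP[].
  by rewrite big_setU1 //= rank_x rank_D1 // opprD expfzDr.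
rewrite ltnS in lemD.
rewrite [in X in _ + X]IHj ?cDx // mulrA -expfzDr //.
have -> : - j.+1%:Z + ('C(m, 2)%:Z - (m * j)%N%:Z) =
    'C(m.+1, 2)%:Z - (m.+1 * j.+1)%N%:Z.
  by rewrite binS bin1; lia.
(* When [m = j], no subset of [D :\ x] has [m.+1] elements; this case is outside the range of
   [qbinomS]. *)
move: lemD; rewrite leq_eqVlt => /orP[/eqP mj|ltmj].
  by rewrite big_subsets_card_lt ?cDx ?mj // add0r !qbinomn.
rewrite IHj ?cDx // qbinomS // mulrDr [in RHS]mulrA; congr (_ * _ + _).
(* The factor [q^(m+1)] of the q-Pascal rule turns [(m+1)(j+1)] into [(m+1)j] in the exponent. *)
by rewrite exprnP -expfzDr //; congr (q ^ _); lia.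
Qed.

End StarSum.

Lemma qvar_neq0 : qvar != 0.
Proof. by rewrite tofrac_eq0 polyX_eq0. Qed.

(** The q-integer comes from a polynomial whose value at [1] is [i+1]. *)
Lemma qint_qvar_neq0 i : qint qvar i.+1 != 0.
Proof.
have -> : qint qvar i.+1 = tofrac (\sum_(j < i.+1) 'X^j).
  by rewrite /qint rmorph_sum; apply: eq_bigr => j _; rewrite rmorphXn.
rewrite tofrac_eq0; apply/eqP => /(congr1 (fun p => p.[1])).
rewrite horner_sum horner0.
under eq_bigr do rewrite hornerXn expr1n.
by rewrite sumr_const card_ord; lia.
Qed.

(** Position [0] is never a descent. *)
Lemma des_lt (n : nat) (s : 'S_n) : (0 < n)%N -> (des s < n)%N.
Proof.
case: n s => // n s _; rewrite ltnS.
have : Des s \subset [set~ ord0].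
  by apply/subsetP => i; rewrite !inE lt0n => /andP[].
by move=> /subset_leq_card; rewrite cardsC1 card_ord.
Qed.

Theorem proposition5p1p1 (n k : nat) (hn : (1 <= n)%N) (hk : (1 <= k <= n)%N) :
  \sum_(sS in starred n (n - k)) qvar ^ starred_maj sS =
  \sum_(1 <= i < k.+1)
     qvar ^ ('C(n - k, 2)%:Z - ((n - k) * (n - i))%N%:Z)
     * qbinom qvar (n - i) (n - k) * euler_mahonian qvar n (n - i).
Proof.
(* Expanding the Eulerian sums and exchanging the order makes both sides sums over [s], to be
   compared term by term. *)
under [RHS]eq_bigr => i _ do rewrite /euler_mahonian mulr_sumr big_mkcond.
rewrite exchange_big /=.
transitivity (\sum_(s : 'S_n)
    \sum_(S : {set 'I_n} | (S \subset Des s) && (#|S| == n - k)%N)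
      qvar ^ starred_maj (s, S)).
  by rewrite pair_big_dep; apply: eq_big => [[s S]|[s S] _]; rewrite ?inE.
apply: eq_bigr => s _; have ltdn := des_lt s hn.
under [LHS]eq_bigr do rewrite /starred_maj /= (expfzDr _ _ qvar_neq0).
(* With fewer than [n - k] descents there is no starring, and on the right [n - i >= n - k > des s]
   for every [i <= k]. *)
rewrite -mulr_sumr; case: (ltnP (des s) (n - k)) => [ltdm|lemd].
  rewrite big_subsets_card_lt // mulr0 big_nat big1 // => i hi.
  by case: eqP => // ?; lia.
rewrite (star_sum qvar_neq0 qint_qvar_neq0) // -/(des s).
(* Only [i = n - des s] contributes on the right; it is at least [1] by [des_lt] and at most [k] by
   [lemd]. *)
have dr : (n - des s)%N \in index_iota 1 k.+1 by rewrite mem_index_iota; lia.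
rewrite (bigD1_seq _ dr) ?iota_uniq //=.
rewrite subKn ?(ltnW ltdn) // eqxx big_nat_cond big1 ?addr0 => [|i hi].
  by rewrite mulrC.
by case: eqP => // ?; lia.
Qed.
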